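(* Let $(P,\omega,\mathcal J,\mathfrak s)$ be an almost Kähler manifold on which a Lie group $G$ acts freely and properly by automorphisms of the almost Kähler structure, with equivariant momentum map $J:P\to\mathfrak g^*$. Then the connection one-form $\mathcal A$ of the abstract mechanical connection on the principal $G$-bundle $P\to P/G$ is given by $$\mathcal A(x)\cdot w=\mathbb I^{-1}(x)\cdot\mathfrak s\big(\omega^\#(dJ(x)),w\big)\qquad\text{for all }x\in P,\ w\in T_xP.$$
   Context: Almost Kähler: $\omega$ is a symplectic form, $\mathcal J$ an almost complex structure ($\mathcal J^2=-1$), $\mathfrak s$ a $\mathcal J$-invariant Riemannian metric, related by $\omega(v,w)=\mathfrak s(\mathcal Jv,w)$. $G$ acts preserving $\omega$, $\mathcal J$ and $\mathfrak s$. $\xi_P$ is the infinitesimal generator of $\xi\in\mathfrak g$. The momentum map $J$ is $\operatorname{Ad}^*$-equivariant, with $\omega(\xi_P,\cdot)=d\langle J,\xi\rangle$. The quotient map $\pi:P\to P/G$ and $J:P\to U=J(P)$ are surjective submersions. $\omega^\#$ sends a one-form $\beta$ to the vector field $\omega^\#(\beta)$ with $\omega(\omega^\#(\beta),\cdot)=\beta$; thus $\xi_P=\omega^\#(d\langle J,\xi\rangle)$. Regarding $dJ$ as a $\mathfrak g^*$-valued one-form, $\mathfrak s(\omega^\#(dJ(x)),w)\in\mathfrak g^*$ is defined by $\langle\mathfrak s(\omega^\#(dJ(x)),w),\eta\rangle=\mathfrak s(\omega^\#(d\langle J,\eta\rangle)(x),w)$ for $\eta\in\mathfrak g$. Abstract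 locked inertia tensor: $\mathbb I(x):\mathfrak g\to\mathfrak g^*$, $\langle\mathbb I(x)\xi,\eta\rangle=\mathfrak s(\xi_P(x),\eta_P(x))$; it is an isomorphism since the action is free. Abstract mechanical connection: the principal connection on $P\to P/G$ with horizontal spaces $\operatorname{hor}(x)=\{v\in T_xP:\mathfrak s(v,\xi_P(x))=0\ \forall\,\xi\in\mathfrak g\}$. Its connection one-form is the $\mathfrak g$-valued one-form $\mathcal A$ with $\operatorname{Ker}\mathcal A(x)=\operatorname{hor}(x)$ and $\mathcal A(\xi_P(x))=\xi$ for all $\xi\in\mathfrak g$. *)

(* Defs.v *)
From HB Require Import structures.
From mathcomp Require Import all_boot all_order all_algebra.
From mathcomp Require Import all_classical all_reals all_analysis.

Set Implicit Arguments.
Unset Strict Implicit.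
Unset Printing Implicit Defensive.
Import Order.TTheory GRing.Theory Num.Theory.
Import numFieldNormedType.Exports.
Local Open Scope classical_set_scope.
Local Open Scope ring_scope.

(** * Smooth maps between normed spaces *)

Section Smooth.
Context {R : realType} {V W : normedModType R}.

(* Meant for [U] open and [V] finite-dimensional, where being C^(k+1) amounts to
   being differentiable with all directional derivatives C^k. *)
Fixpoint Ck_on (k : nat) (U : set V) (f : V -> W) : Prop :=
  match k with
  | 0 => forall y, U y -> {for y, continuous f}
  | k'.+1 => (forall y, U y -> differentiable f y) /\
             (forall v : V, Ck_on k' U ('D_v f))
  end.

Definition smooth_on (U : set V) (f : V -> W) : Prop := forall k, Ck_on k U f.

Definition smooth_at (y : V) (f : V -> W) : Prop :=
  exists2 U : set V, open_nbhs y U & smooth_on U f.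

End Smooth.

(** * Smooth manifolds *)

(* A smooth manifold of dimension [n] is given by an atlas with one preferred
   chart [chart x], of domain [chart_dom x], around each point [x]; outside
   the chart domains and images the values of [chart] and [chart_inv] are
   irrelevant. *)
HB.mixin Record Topological_isManifold (R : realType) (n : nat) M
    & Topological M := {
  chart_dom : M -> set M ;
  chart : M -> M -> 'rV[R]_n ;
  chart_inv : M -> 'rV[R]_n -> M ;
  manifold_hausdorff : hausdorff_space M ;
  manifold_second_countable : @second_countable M ;
  chart_dom_open : forall x, open (chart_dom x) ;
  mem_chart_dom : forall x, chart_dom x x ;
  chart_img_open : forall x, open (chart x @` chart_dom x) ;
  chartK : forall x p, chart_dom x p -> chart_inv x (chart x p) = p ;
  chart_continuous :
    forall x p, chart_dom x p -> {for p, continuous (chart x)} ;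
  chart_inv_continuous :
    forall x y, (chart x @` chart_dom x) y -> {for y, continuous (chart_inv x)} ;
  chart_transition_smooth :
    forall x x', smooth_on (chart x @` (chart_dom x `&` chart_dom x'))
                           (chart x' \o chart_inv x)
}.

#[short(type="manifoldType")]
HB.structure Definition Manifold (R : realType) (n : nat) :=
  { M of Topological_isManifold R n M & Topological M }.

Definition chart_img (R : realType) (n : nat) (M : manifoldType R n) (x : M) :
  set 'rV[R]_n := chart x @` chart_dom x.

(* T_x M is represented by the coordinates of tangent vectors in the preferred
   chart at [x]. *)
Definition tangent (R : realType) (n : nat) (M : manifoldType R n) (x : M) :=
  'rV[R]_n.

Definition dual (R : realType) (V : vectType R) := 'Hom(V, R^o).

Section Maps.
Context {R : realType} {n1 n2 n3 : nat}.
Variables (M1 : manifoldType R n1) (M2 : manifoldType R n2)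
  (M3 : manifoldType R n3).

Definition smooth_map (f : M1 -> M2) : Prop :=
  continuous f /\
  forall x, smooth_at (chart x x) (chart (f x) \o f \o chart_inv x).

(* Smoothness of a map [M1 * M2 -> M3], using product charts. *)
Definition smooth_map2 (f : M1 -> M2 -> M3) : Prop :=
  continuous (fun z : M1 * M2 => f z.1 z.2) /\
  forall (a : M1) (b : M2), smooth_at (chart a a, chart b b)
    (fun z : 'rV[R]_n1 * 'rV[R]_n2 =>
       chart (f a b) (f (chart_inv a z.1) (chart_inv b z.2))).

Definition tangent_map (f : M1 -> M2) (x : M1) (v : tangent x) :
    tangent (f x) :=
  'd (chart (f x) \o f \o chart_inv x) (chart x x) v.

Definition smooth_fun (f : M1 -> R^o) : Prop :=
  forall x, smooth_at (chart x x) (f \o chart_inv x).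

Definition dfun (f : M1 -> R^o) (x : M1) : dual (tangent x) :=
  linfun ('d (f \o chart_inv x) (chart x x)).

End Maps.
Arguments tangent_map {R n1 n2 M1 M2} f x v.

(** * Tensor fields *)

Section Tensors.
Context {R : realType} {n : nat} (M : manifoldType R n).

Definition bilinear_field := forall x : M, 'Hom(tangent x, dual (tangent x)).
Definition endo_field := forall x : M, 'End(tangent x).

(* The coordinate vector field of the chart at [x] in direction [u]. *)
Definition coord_field (x : M) (u : 'rV[R]_n) (p : M) : tangent p :=
  'd (chart p \o chart_inv x) (chart x p) u.

(* The components, in the chart at [x], of a tangent vector at [p]. *)
Definition coord_of (x p : M) (v : tangent p) : 'rV[R]_n :=
  'd (chart x \o chart_inv p) (chart p p) v.
Arguments coord_of x p v : clear implicits.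

Definition coef (b : bilinear_field) (x : M) (u v : 'rV[R]_n)
    (y : 'rV[R]_n) : R^o :=
  let p := chart_inv x y in b p (coord_field x u p) (coord_field x v p).

Definition smooth_bilinear (b : bilinear_field) : Prop :=
  forall (x : M) (u v : 'rV[R]_n), smooth_on (chart_img x) (coef b x u v).

Definition smooth_endo (E : endo_field) : Prop :=
  forall (x : M) (u : 'rV[R]_n), smooth_on (chart_img x)
    (fun y => let p := chart_inv x y in
              coord_of x p (E p (coord_field x u p))).

Definition smooth_one_form (m : nat)
    (A : forall x : M, 'Hom(tangent x, 'rV[R]_m)) : Prop :=
  forall (x : M) (u : 'rV[R]_n), smooth_on (chart_img x)
    (fun y => let p := chart_inv x y in A p (coord_field x u p)).

(* d b = 0, evaluated on (commuting) coordinate vector fields. *)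
Definition closed_two_form (b : bilinear_field) : Prop :=
  forall (x : M) (u v w y : 'rV[R]_n), chart_img x y ->
    'D_u (coef b x v w) y + 'D_v (coef b x w u) y + 'D_w (coef b x u v) y = 0.

Record symplectic (omega : bilinear_field) : Prop := Symplectic {
  symplectic_smooth : smooth_bilinear omega ;
  symplectic_alternating : forall x (v : tangent x), omega x v v = 0 ;
  symplectic_closed : closed_two_form omega ;
  symplectic_nondegenerate : forall x (v : tangent x),
    (forall w : tangent x, omega x v w = 0) -> v = 0
}.

Record riemannian (s : bilinear_field) : Prop := Riemannian {
  riemannian_smooth : smooth_bilinear s ;
  riemannian_sym : forall x (v w : tangent x), s x v w = s x w v ;
  riemannian_pos : forall x (v : tangent x), v != 0 -> 0 < s x v v
}.

Record almost_complex (JJ : endo_field) : Prop := AlmostComplex {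
  almost_complex_smooth : smooth_endo JJ ;
  almost_complex_sqr : forall x (v : tangent x), JJ x (JJ x v) = - v
}.

Record almost_kahler (omega : bilinear_field) (JJ : endo_field)
    (s : bilinear_field) : Prop := AlmostKahler {
  almost_kahler_symplectic : symplectic omega ;
  almost_kahler_complex : almost_complex JJ ;
  almost_kahler_riemannian : riemannian s ;
  almost_kahler_invariant : forall x (v w : tangent x),
    s x (JJ x v) (JJ x w) = s x v w ;
  almost_kahler_compat : forall x (v w : tangent x),
    omega x v w = s x (JJ x v) w
}.

Record almost_kahler_morphism (omega : bilinear_field) (JJ : endo_field)
    (s : bilinear_field) (f : M -> M) : Prop := AlmostKahlerMorphism {
  preserves_omega : forall x (v w : tangent x),
    omega (f x) (tangent_map f x v) (tangent_map f x w) = omega x v w ;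
  preserves_JJ : forall x (v : tangent x),
    JJ (f x) (tangent_map f x v) = tangent_map f x (JJ x v) ;
  preserves_s : forall x (v w : tangent x),
    s (f x) (tangent_map f x v) (tangent_map f x w) = s x v w
}.

(* [omega x : T_x M -> T_x^* M] is [v |-> omega(v, .)], so its inverse sends
   [beta] to the vector [v] with [omega(v, .) = beta]. *)
Definition sharp (omega : bilinear_field) (x : M) :
  'Hom(dual (tangent x), tangent x) := ((omega x)^-1)%VF.

End Tensors.
Arguments coord_of {R n M} x p v.

(** * Lie groups and their actions *)

HB.mixin Record Manifold_isLieGroup (R : realType) (m : nat) G
    & Manifold R m G & Group G := {
  lie_mul_smooth : smooth_map2 (fun g h : G => (g * h)%g) ;
  lie_inv_smooth : smooth_map (fun g : G => (g^-1)%g)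
}.

#[short(type="lieGroupType")]
HB.structure Definition LieGroup (R : realType) (m : nat) :=
  { G of Manifold_isLieGroup R m G & Manifold R m G & Group G }.

Definition lie_algebra (R : realType) (m : nat) (G : lieGroupType R m) :=
  tangent (1%g : G).

Section Actions.
Context {R : realType} {m n : nat} (G : lieGroupType R m)
  (P : manifoldType R n).
Local Notation LG := (lie_algebra G).

(* The values lie in the tangent space at [g * 1 * g^-1], that is at [1]. *)
Definition Ad (g : G) (xi : LG) : LG :=
  tangent_map (fun h : G => (g * h * g^-1)%g) 1%g xi.

(* Left coadjoint action: <Ad^*_{g^-1} mu, xi> = <mu, Ad_{g^-1} xi>. *)
Definition coAd (g : G) (mu : dual LG) : dual LG :=
  linfun (fun xi : LG => mu (Ad (g^-1)%g xi)).

Record smooth_action (act : G -> P -> P) : Prop := SmoothAction {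
  act1 : forall x, act 1%g x = x ;
  actM : forall g h x, act (g * h)%g x = act g (act h x) ;
  act_smooth : smooth_map2 act
}.

Definition free_action (act : G -> P -> P) : Prop :=
  forall g x, act g x = x -> g = 1%g.

Definition proper_action (act : G -> P -> P) : Prop :=
  forall K : set (P * P), compact K ->
    compact ((fun z : G * P => (z.2, act z.1 z.2)) @^-1` K).

(* xi_P(x), the derivative at [1] of the orbit map [g |-> act g x]; its value
   lies in the tangent space at [act 1 x], that is at [x]. *)
Definition generator (act : G -> P -> P) (xi : LG) (x : P) : tangent x :=
  tangent_map (fun g : G => act g x) 1%g xi.

Definition dmoment (J : P -> dual LG) (xi : LG) (x : P) : dual (tangent x) :=
  dfun (fun p => J p xi) x.

Record equivariant_momentum_map (omega : bilinear_field P)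
    (act : G -> P -> P) (J : P -> dual LG) : Prop := EquivariantMomentumMap {
  momentum_smooth : forall xi : LG, smooth_fun (fun p => J p xi) ;
  momentum_generator : forall (xi : LG) (x : P),
    omega x (generator act xi x) = dmoment J xi x ;
  momentum_equivariant : forall g x, J (act g x) = coAd g (J x)
}.

Definition locked_inertia (s : bilinear_field P) (act : G -> P -> P) (x : P) :
    'Hom(LG, dual LG) :=
  linfun (fun xi : LG =>
    linfun (fun eta : LG => s x (generator act xi x) (generator act eta x))
      : dual LG).

Definition horizontal (s : bilinear_field P) (act : G -> P -> P) (x : P) :
    set (tangent x) :=
  [set v | forall xi : LG, s x v (generator act xi x) = 0].
Arguments horizontal s act x : clear implicits.

Record mechanical_connection_form (s : bilinear_field P) (act : G -> P -> P)
    (A : forall x : P, 'Hom(tangent x, LG)) : Prop :=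
  MechanicalConnectionForm {
  mechanical_smooth : smooth_one_form A ;
  mechanical_ker : forall x,
    [set v : tangent x | v \in lker (A x)] = horizontal s act x ;
  mechanical_generator : forall (xi : LG) (x : P),
    A x (generator act xi x) = xi
}.

(* The element s(omega^#(dJ(x)), w) of the dual of the Lie algebra. *)
Definition s_sharp_dJ (omega s : bilinear_field P) (J : P -> dual LG)
    (x : P) (w : tangent x) : dual LG :=
  linfun (fun eta : LG => s x (sharp omega x (dmoment J eta x)) w).

End Actions.
Arguments horizontal {R m n G P} s act x.
Arguments s_sharp_dJ {R m n G P} omega s J x w.

(* Main.v *)
Require Import Defs.
From HB Require Import structures.
From mathcomp Require Import all_boot all_order all_algebra.
From mathcomp Require Import all_classical all_reals all_analysis.
Set Implicit Arguments.
Unset Strict Implicit.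
Unset Printing Implicit Defensive.
Import Order.TTheory GRing.Theory Num.Theory.
Import numFieldNormedType.Exports.
Local Open Scope classical_set_scope.
Local Open Scope ring_scope.

(** The inverses in the formula are undone one at a time. Since [omega] is
    nondegenerate, [sharp omega x] really inverts [omega x], so the momentum
    map identity says that the sharp of [d<J, eta>] is the generator [eta_P];
    hence [<s(sharp dJ, w), eta> = s(eta_P, w)] ([s_sharp_dJE]). The connection
    form splits [w] into the vertical vector generated by [A x w] and a
    horizontal remainder, which is [s]-orthogonal to [eta_P]; therefore
    [s(eta_P, w) = s((A x w)_P, eta_P)], that is,
    [s(sharp dJ, w) = I(x) (A x w)] ([locked_inertia_connection]). Finally
    [I(x)] is injective: [<I(x) xi, xi>] is the square of the length of
    [xi_P(x)], and [A] recovers [xi] from [xi_P(x)]. *)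

Lemma injective_lfunK (K : fieldType) (aT rT : vectType K) (f : 'Hom(aT, rT)) :
  (forall v, f v = 0 -> v = 0) -> cancel f (f^-1)%VF.
Proof.
move=> f0; apply: lker0_lfunK; apply/eqP/vspaceP => v.
rewrite memv_ker memv0.
by apply/eqP/eqP => [/f0|->] //; rewrite linear0.
Qed.

(** [linfun f] agrees with [f] only when [f] is linear; this form takes the
    linearity as a proof instead of a canonical structure on [f]. *)
Lemma linfun_linearE (K : fieldType) (aT rT : vectType K) (f : aT -> rT)
  (f_lin : linear f) : linfun f =1 f.
Proof.
pose F := GRing.isLinear.Build _ _ _ _ f f_lin.
pose g : {linear aT -> rT} := HB.pack f F.
exact: (lfunE g).
Qed.

Section Generators.
Context {R : realType} {m n : nat} (G : lieGroupType R m)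
  (P : manifoldType R n).
Variables (omega s : bilinear_field P) (act : G -> P -> P).

Lemma generator_linear (x : P) :
  linear (fun xi : lie_algebra G => generator act xi x).
Proof. by move=> a u v; rewrite /generator /tangent_map linearP. Qed.

Lemma locked_inertiaE (x : P) (xi eta : lie_algebra G) :
  locked_inertia s act x xi eta = s x (generator act xi x) (generator act eta x).
Proof.
have inner_lin (zeta : lie_algebra G) : linear (fun eta : lie_algebra G =>
    s x (generator act zeta x) (generator act eta x) : R^o).
  by move=> a u v; rewrite generator_linear linearP.
rewrite /locked_inertia linfun_linearE ?linfun_linearE // => a u v.
apply/lfunP => zeta; rewrite add_lfunE scale_lfunE !linfun_linearE //.
by rewrite generator_linear linearP add_lfunE scale_lfunE.
Qed.

(** Applying the sharp to [omega(eta_P, .) = d<J, eta>] gives [eta_P] back. *)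
Lemma sharp_dmoment (J : P -> dual (lie_algebra G)) (eta : lie_algebra G)
    (x : P) :
  symplectic omega -> equivariant_momentum_map omega act J ->
  sharp omega x (dmoment J eta x) = generator act eta x.
Proof.
move=> hom hJ; rewrite -(momentum_generator hJ) /sharp.
apply: injective_lfunK => v omega_v0.
apply: (symplectic_nondegenerate hom (x := x)) => w.
by move/lfunP/(_ w): omega_v0; rewrite zero_lfunE.
Qed.

Lemma s_sharp_dJE (J : P -> dual (lie_algebra G)) (x : P) (w : tangent x)
    (eta : lie_algebra G) :
  symplectic omega -> equivariant_momentum_map omega act J ->
  s_sharp_dJ omega s J x w eta = s x (generator act eta x) w.
Proof.
move=> hom hJ; rewrite /s_sharp_dJ linfun_linearE ?(sharp_dmoment _ _ hom hJ) //.
move=> a u v; rewrite !(sharp_dmoment _ _ hom hJ) generator_linear linearP.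
by rewrite add_lfunE scale_lfunE.
Qed.

Section Connection.
Variable A : forall x : P, 'Hom(tangent x, lie_algebra G).
Hypotheses (hs : riemannian s) (hA : mechanical_connection_form s act A).

Lemma locked_inertia_injective (x : P) (xi : lie_algebra G) :
  locked_inertia s act x xi = 0 -> xi = 0.
Proof.
move=> I0; rewrite -(mechanical_generator hA xi x).
have [->|/(riemannian_pos hs)] := eqVneq (generator act xi x) 0.
  by rewrite linear0.
by rewrite -locked_inertiaE I0 zero_lfunE ltxx.
Qed.

(** The remainder [w - (A x w)_P] is killed by [A x], hence horizontal, so [w]
    may be replaced by its vertical part when paired with a generator. *)
Lemma locked_inertia_connection (x : P) (w : tangent x)
    (eta : lie_algebra G) :
  locked_inertia s act x (A x w) eta = s x (generator act eta x) w.
Proof.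
have : horizontal s act x (w - generator act (A x w) x).
  rewrite -(mechanical_ker hA) /= memv_ker linearB /=.
  by rewrite (mechanical_generator hA) subrr.
move=> /(_ eta); rewrite linearB add_lfunE opp_lfunE => /eqP.
by rewrite subr_eq0 locked_inertiaE => /eqP <-; exact: riemannian_sym hs _ _ _.
Qed.

End Connection.
End Generators.

Theorem theorem4p4 (R : realType) (m n : nat)
    (G : lieGroupType R m) (P : manifoldType R n)
    (omega : bilinear_field P) (JJ : endo_field P) (s : bilinear_field P)
    (act : G -> P -> P) (J : P -> dual (lie_algebra G))
    (A : forall x : P, 'Hom(tangent x, lie_algebra G))
    (hP : almost_kahler omega JJ s)
    (hact : smooth_action act)
    (hfree : free_action act)
    (hproper : proper_action act)
    (haut : forall g : G, almost_kahler_morphism omega JJ s (act g))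
    (hJ : equivariant_momentum_map omega act J)
    (hA : mechanical_connection_form s act A)
    (x : P) (w : tangent x) :
  A x w = ((locked_inertia s act x)^-1)%VF (s_sharp_dJ omega s J x w).
Proof.
have hom := almost_kahler_symplectic hP.
have hs := almost_kahler_riemannian hP.
have -> : s_sharp_dJ omega s J x w = locked_inertia s act x (A x w).
  apply/lfunP => eta.
  by rewrite (s_sharp_dJE _ _ _ hom hJ) (locked_inertia_connection hs hA).
by rewrite (injective_lfunK (@locked_inertia_injective _ _ _ _ _ _ _ _ hs hA x)).
Qed.
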